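(* Let $S=T\circ T\circ T$ be the third iterate of the Collatz map $T:\mathbb{N}\to\mathbb{N}$. For every integer $m\ge1$ let $Q(m)=(q_{ij}(m))_{i,j=0,\dots,8^m-1}$ be the $8^m\times 8^m$ matrix with entries $$q_{ij}(m):=\frac{\mu_{inv}\left[\mathcal{B}(i,8^m)\cap S^{-1}\mathcal{B}(j,8^m)\right]}{\mu_{inv}\left[\mathcal{B}(i,8^m)\right]}\qquad (i,j=0,\dots,8^m-1).$$ Then for every $m\ge 1$ the matrix $Q(m)$ is stochastic (nonnegative entries, each row summing to $1$). Moreover, the stationary distribution $\vec{P}_{stat}(m)$ of $Q(m)$, i.e. the probability row vector solving $\vec{P}_{stat}(m)\,Q(m)=\vec{P}_{stat}(m)$, is unique and is the vector of $\mathbb{R}^{8^m}$ given by $$\vec{P}_{stat}(m)=(a,b,a,b,\dots,a,b),\qquad a=\frac16\cdot\frac1{8^{m-1}},\quad b=\frac1{12}\cdot\frac1{8^{m-1}},$$ with entry $a$ at the even indices $i$ and entry $b$ at the odd indices $i$, for $i\in\{0,\dots,8^m-1\}$.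
   Context: $\mathbb{N}$ denotes the positive integers. The Collatz map $T:\mathbb{N}\to\mathbb{N}$ is $T(n)=n/2$ if $n$ is even and $T(n)=3n+1$ if $n$ is odd. For $m\ge1$ and $i\in\{0,\dots,8^m-1\}$, $\mathcal{B}(i,8^m)=\{n\in\mathbb{N}:\exists k\in\mathbb{N}\cup\{0\},\ n=i+8^mk\}$. $S^{-1}A$ denotes the preimage $\{n\in\mathbb{N}:S(n)\in A\}$. $\mu_{inv}$ is the finitely additive set function, defined on finite unions of classes $\mathcal{B}(i,8^m)$ ($m\ge 1$, $0\le i\le 8^m-1$), determined by $$\mu_{inv}(\mathcal{B}(i,8^m))=\frac{\nu(i)}{8^{m-1}},\qquad \nu(i)=\tfrac16 \text{ if } i \text{ is even},\quad \nu(i)=\tfrac1{12}\text{ if } i\text{ is odd}.$$ The sets $\mathcal{B}(i,8^m)\cap S^{-1}\mathcal{B}(j,8^m)$ are finite unions of classes modulo $8^{m+1}$ (the empty union being allowed, with value $0$), so their $\mu_{inv}$-values are defined. *)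

(* Defs.v *)
From HB Require Import structures.
From mathcomp Require Import all_boot all_order all_algebra.
From mathcomp Require Import all_classical all_reals.

Set Implicit Arguments.
Unset Strict Implicit.
Unset Printing Implicit Defensive.

Import Order.TTheory GRing.Theory Num.Theory.

Local Open Scope classical_set_scope.
Local Open Scope ring_scope.

(* The Collatz map lives on the positive integers, which it preserves.  It is
   extended to nat with collatz 0 = 0, so that 0 never enters the preimage of
   a set of positive integers. *)
Definition collatz (n : nat) : nat := if odd n then (3 * n + 1)%N else n./2.

Definition collatz3 : nat -> nat := collatz \o collatz \o collatz.

Definition residue_class (i q : nat) : set nat :=
  [set n | (0 < n)%N /\ exists k : nat, n = (i + q * k)%N].

Section Measure.
Variable R : realType.

Definition nu (i : nat) : R := if odd i then 12%:R^-1 else 6%:R^-1.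

(* A is the union of the classes modulo 8 ^ m with index in E and v is the sum
   of their measures.  Refining to a common modulus, every finite union of
   classes modulo powers of 8 has such a presentation at a single level m. *)
Definition presents (A : set nat) (m : nat) (E : {set 'I_(8 ^ m)}) (v : R) :=
  [/\ (0 < m)%N,
      A = \bigcup_(i in [set i | i \in E]) residue_class i (8 ^ m) &
      v = \sum_(i in E) nu i / 8%:R ^+ m.-1].

(* The value does not depend on the presentation (mu_invE); mu_inv_class and
   mu_invU give the values on classes and finite additivity.  Sets without a
   presentation get the junk value 0. *)
Definition mu_inv (A : set nat) : R :=
  xget 0 [set v | exists m (E : {set 'I_(8 ^ m)}), presents A E v].

Definition collatz_matrix (m : nat) : 'M[R]_(8 ^ m) :=
  \matrix_(i, j)
    (mu_inv (residue_class i (8 ^ m) `&`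
             collatz3 @^-1` residue_class j (8 ^ m))
     / mu_inv (residue_class i (8 ^ m))).

Definition stochastic (n : nat) (P : 'M[R]_n) : Prop :=
  (forall i j, 0 <= P i j) /\ (forall i, \sum_j P i j = 1).

Definition stationary_distribution (n : nat) (P : 'M[R]_n) (p : 'rV[R]_n) :
    Prop :=
  [/\ forall i, 0 <= p 0 i, \sum_i p 0 i = 1 & p *m P = p].

(* i + 8 ^ m is a positive representative of the class of i, also for i = 0. *)
Definition level_sum (A : set nat) (m : nat) : R :=
  \sum_(0 <= i < 8 ^ m | `[< A (i + 8 ^ m)%N >]) nu i / 8%:R ^+ m.-1.

Lemma residue_classP (m n : nat) (i : 'I_(8 ^ m)) :
  residue_class i (8 ^ m) n <-> (0 < n)%N /\ (n %% 8 ^ m)%N = i.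
Proof.
split=> [[n0 [k nE]]|[n0 ni]]; split => //.
- by rewrite nE addnC (mulnC _ k) modnMDl modn_small.
- by exists (n %/ 8 ^ m)%N; rewrite -ni addnC (mulnC (8 ^ m)%N) -divn_eq.
Qed.

Lemma bigcup_classE (m n : nat) (E : {set 'I_(8 ^ m)}) (i : 'I_(8 ^ m)) :
  (n %% 8 ^ m)%N = i ->
  (\bigcup_(j in [set j | j \in E]) residue_class j (8 ^ m)) n <->
  (0 < n)%N /\ i \in E.
Proof.
move=> ni; split=> [[j /= jE /residue_classP [n0 nj]]|[n0 iE]].
- by split => //; rewrite (_ : i = j) //; apply/val_inj; rewrite /= -ni -nj.
- by exists i => //; apply/residue_classP.
Qed.

Lemma presents_level_sum (A : set nat) (m : nat) (E : {set 'I_(8 ^ m)}) v :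
  presents A E v -> v = level_sum A m.
Proof.
move=> [m0 -> ->]; rewrite /level_sum big_mkord; apply: eq_bigl => i.
have ni : ((i + 8 ^ m) %% 8 ^ m)%N = i by rewrite modnDr modn_small.
apply/idP/asboolP => [iE|/(bigcup_classE E ni)[]//].
by apply/(bigcup_classE E ni); rewrite addn_gt0 expn_gt0 orbT.
Qed.

Lemma big_nat_block (f : nat -> R) (k N : nat) :
  \sum_(0 <= i < k * N) f i = \sum_(0 <= r < k) \sum_(0 <= i < N) f (r * N + i)%N.
Proof.
elim: k => [|k IH]; first by rewrite mul0n !big_geq.
rewrite big_nat_recr //= -IH mulSn addnC (@big_cat_nat _ _ _ (k * N)) ?leq_addr//=.
congr (_ + _).
rewrite -{1}[(k * N)%N]add0n big_addn addKn.
by apply: eq_bigr => i _; rewrite addnC.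
Qed.

Lemma presents_mod (A : set nat) (m p n n' : nat) (E : {set 'I_(8 ^ m)}) v :
  presents A E v -> (m <= p)%N -> (0 < n)%N -> (0 < n')%N ->
  n = n' %[mod 8 ^ p] -> A n <-> A n'.
Proof.
move=> [m0 -> _] mp n0 n'0 nn'.
have lt : (n %% 8 ^ m < 8 ^ m)%N by rewrite ltn_mod expn_gt0.
have e : (n %% 8 ^ m)%N = Ordinal lt by [].
have e' : (n' %% 8 ^ m)%N = Ordinal lt.
  by rewrite /= -(modn_dvdm n (dvdn_exp2l 8 mp)) nn' modn_dvdm // dvdn_exp2l.
by split=> [/(bigcup_classE E e)|/(bigcup_classE E e')] [_ h];
   [apply/(bigcup_classE E e')|apply/(bigcup_classE E e)].
Qed.

Lemma level_sumS (A : set nat) (m p : nat) (E : {set 'I_(8 ^ m)}) v :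
  presents A E v -> (m <= p)%N -> level_sum A p.+1 = level_sum A p.
Proof.
move=> AE mp; have p0 : (0 < p)%N by case: AE => m0 _ _; exact: leq_trans mp.
rewrite /level_sum big_mkcond [RHS]big_mkcond expnS big_nat_block /=.
under eq_bigr => r _.
  under eq_bigr => i _.
    have -> : `[< A (r * 8 ^ p + i + 8 * 8 ^ p)%N >] = `[< A (i + 8 ^ p)%N >].
      apply: asbool_equiv_eq; apply: (presents_mod AE mp).
      - by rewrite addn_gt0 muln_gt0 expn_gt0 orbT.
      - by rewrite addn_gt0 expn_gt0 orbT.
      - by rewrite addnC modnMDl modnMDl modnDr.
    have -> : nu (r * 8 ^ p + i)%N = nu i.
      by rewrite /nu oddD oddM oddX (gtn_eqF p0) andbF.
    over.
  over.
rewrite /= sumr_const_nat subn0 -sumrMnl; apply: eq_bigr => i _.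
case: ifP => _; last by rewrite mul0rn.
rewrite -[in LHS](prednK p0) exprS invfM mulrCA -mulrnAl -[_ *+ 8]mulr_natr.
by rewrite mulVf ?mul1r// pnatr_eq0.
Qed.

Lemma level_sum_add (A : set nat) (m q : nat) (E : {set 'I_(8 ^ m)}) v :
  presents A E v -> level_sum A (m + q) = v.
Proof.
move=> AE; elim: q => [|q <-]; first by rewrite addn0 (presents_level_sum AE).
by rewrite addnS (level_sumS AE) // leq_addr.
Qed.

Lemma presents_up (A : set nat) (m q : nat) (E : {set 'I_(8 ^ m)}) v :
  presents A E v ->
  presents A [set i : 'I_(8 ^ (m + q)) | `[< A (i + 8 ^ (m + q))%N >]]%SET v.
Proof.
move=> AE; have [m0 _ _] := AE; split; first by rewrite addn_gt0 m0.
- apply/seteqP; split=> n.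
  + move=> An.
    have n0 : (0 < n)%N by move: An; case: AE => _ -> _ [i _ []].
    have lt : (n %% 8 ^ (m + q) < 8 ^ (m + q))%N by rewrite ltn_mod expn_gt0.
    exists (Ordinal lt); last exact/residue_classP.
    rewrite /= inE; apply/asboolP; move: An; apply: (presents_mod AE (leq_addr q m) _ _ _).1.
    * exact: n0.
    * by rewrite addn_gt0 expn_gt0 orbT.
    * by rewrite /= modnDr modn_mod.
  + move=> [i /=]; rewrite inE => /asboolP Ai /residue_classP [n0 ni].
    move: Ai; apply: (presents_mod AE (leq_addr q m) _ _ _).1.
    * by rewrite addn_gt0 expn_gt0 orbT.
    * exact: n0.
    * by rewrite /= modnDr -ni modn_mod.
- rewrite -(level_sum_add q AE) /level_sum big_mkord.
  by apply: eq_bigl => i; rewrite inE.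
Qed.

Lemma mu_invE (A : set nat) (m : nat) (E : {set 'I_(8 ^ m)}) (v : R) :
  presents A E v -> mu_inv A = v.
Proof.
move=> AE; rewrite /mu_inv; case: xgetP => [_ -> [p [F AF]]|/(_ v) nA].
- by rewrite -(level_sum_add m AF) addnC (level_sum_add p AE).
- by case: nA; exists m, E.
Qed.

Lemma mu_inv_class (m : nat) (i : 'I_(8 ^ m)) : (0 < m)%N ->
  mu_inv (residue_class i (8 ^ m)) = nu i / 8%:R ^+ m.-1.
Proof.
move=> m0; apply: (@mu_invE _ m [set i]%SET); split => //.
- apply/seteqP; split=> n /=; first by exists i => //=; rewrite inE.
  by move=> [j /=]; rewrite inE => /eqP ->.
- by rewrite big_set1.
Qed.

Lemma mu_invU (A B : set nat) (m p : nat) (E : {set 'I_(8 ^ m)})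
    (F : {set 'I_(8 ^ p)}) (v w : R) :
  presents A E v -> presents B F w -> A `&` B = set0 ->
  mu_inv (A `|` B) = mu_inv A + mu_inv B.
Proof.
move=> AE BF AB0; rewrite (mu_invE AE) (mu_invE BF).
move: (presents_up p AE) (presents_up m BF); rewrite (addnC p m).
set G := finset _; set H := finset _ => -[mp AG vG] [_ BH wH].
apply: (@mu_invE _ _ (G :|: H)%SET); split => //.
- rewrite AG BH -bigcup_setU; apply: eq_bigcupl.
  by split=> i /=; rewrite finset.in_setU => /orP.
- rewrite vG wH -bigU /=; first by apply: eq_bigl => i; rewrite !inE.
  apply/pred0P => i /=; rewrite !inE; apply/negbTE/negP => /andP[].
  move=> /asboolP Ai /asboolP Bi.
  suff : set0 (i + 8 ^ (m + p))%N by [].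
  by rewrite -AB0.
Qed.

End Measure.

(* Main.v *)
Require Import Defs.
From HB Require Import structures.
From mathcomp Require Import all_boot all_order all_algebra.
From mathcomp Require Import all_classical all_reals.
From mathcomp Require Import zify ring lra.

(** Write T for [collatz], S for [collatz3] and Q for the matrix at level m.

    One step of T loses at most one binary digit, so S n mod 8 ^ m is
    determined by n mod 8 ^ (m + 1).  Hence B(i, 8 ^ m) meets S^-1 B(j, 8 ^ m)
    in a union of classes modulo 8 ^ (m + 1), all of measure nu i / 8 ^ m
    because nu depends on parity only, and q_ij is one eighth of the number of residues u modulo
    8 ^ (m + 1) with u = i and S u = j modulo 8 ^ m ([collatz_matrixE]).  Each
    i has eight lifts u, and each lift has a single image, so Q is stochastic.

    Stationarity is the invariance of the measure under S, and the measure is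
    already invariant under T ([sum_collatz]).  Indeed for f of period 2 ^ k
    the even u contribute the mean of f over all classes, and the odd u, where
    T (2a + 1) = 2 (3a + 2), contribute the mean of f over even classes because
    a |-> 3a + 2 permutes residues modulo powers of 2.  Three iterations give S.

    For uniqueness, the state 0 is accessible from every state
    ([connect_zero]).  On the class of x modulo 2 ^ L, the parities consumed by
    T until L halvings have occurred are the same for all members, so for a
    suitable N the iterate is affine, T^N (x + 2 ^ L t) = T^N x + 3 ^ b t
    ([iter_collatz_affine]).  As 3 ^ b is odd, t can be chosen to make this
    divisible by a high power of 2; from there T only halves, and some iterate
    of S falls into the class of 0.  A finite stochastic matrix with a state
    accessible from all others has at most one stationary distribution
    ([invariant_sum0]): if v is invariant then so is |v|
    ([invariant_abs]), hence so are the nonnegative vectors |v| - v and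
    |v| + v; one of them vanishes at the accessible state, so it vanishes
    everywhere and v has constant sign, which for a difference of two
    probability vectors forces v = 0. *)

Import Order.TTheory GRing.Theory Num.Theory.
Local Open Scope ring_scope.

(** * Sums of periodic functions *)

Definition periodic {V : Type} (N : nat) (f : nat -> V) : Prop :=
  forall n, f (n + N)%N = f n.

Lemma periodic_mod {V : Type} (N : nat) (f : nat -> V) (n : nat) :
  periodic N f -> f (n %% N)%N = f n.
Proof.
move=> fN; rewrite [in RHS](divn_eq n N) addnC.
by elim: (n %/ N)%N => [|q IH]; rewrite ?mul0n ?addn0// mulSn addnCA addnC fN.
Qed.

Lemma sum_periodic_block {R : realType} (N c : nat) (f : nat -> R) :
  periodic N f ->
  \sum_(0 <= u < c * N) f u = c%:R * \sum_(0 <= u < N) f u.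
Proof.
move=> fN; rewrite big_nat_block.
under eq_bigr => r _.
  under eq_bigr => i _ do rewrite -(periodic_mod _ _ _ fN) modnMDl periodic_mod//.
  over.
by rewrite sumr_const_nat subn0 mulr_natl.
Qed.

(** An affine map whose slope is prime to N permutes the residues modulo N. *)
Lemma sum_periodic_affine {R : realType} (N c d : nat) (f : nat -> R) :
  periodic N f -> coprime N c ->
  \sum_(0 <= u < N) f (c * u + d)%N = \sum_(0 <= u < N) f u.
Proof.
move=> fN cN; case: N => [|N] in fN cN *; first by rewrite !big_geq.
rewrite !big_mkord.
pose h (u : 'I_N.+1) : 'I_N.+1 := inord ((c * u + d) %% N.+1).
have hE u : h u = ((c * u + d) %% N.+1)%N :> nat by rewrite inordK // ltn_mod.
have h_inj : injective h.
  move=> u v /(congr1 val) /=; rewrite !hE => /eqP.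
  rewrite eqn_modDr.
  wlog uv : u v / (v <= u)%N.
    move=> H; case: (leqP v u) => [/H//|/ltnW /H {}H].
    by rewrite eq_sym => /H.
  rewrite eqn_mod_dvd ?leq_mul// -mulnBr Gauss_dvdr// => d_uv.
  apply/val_inj/eqP; rewrite eqn_leq uv andbT -subn_eq0.
  by apply: contraTT d_uv => nz; rewrite gtnNdvd ?lt0n// ltn_subLR// ltn_addl.
rewrite [RHS](reindex_inj h_inj).
by apply: eq_bigr => u _; rewrite hE periodic_mod.
Qed.

(** * The Collatz map on residues modulo powers of 2 *)

Lemma collatz_even (n : nat) : collatz (n.*2) = n.
Proof. by rewrite /collatz odd_double doubleK. Qed.

Lemma collatz_odd (n : nat) : collatz (n.*2.+1) = (3 * n + 2).*2.
Proof. rewrite /collatz /= odd_double /=; lia. Qed.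

(** This is the loss of one binary digit per step: the class of T n modulo N
    depends on n modulo 2 N only. *)
Lemma periodic_collatz {V : Type} (N : nat) (f : nat -> V) :
  periodic N f -> periodic N.*2 (f \o collatz).
Proof.
move=> fN n; rewrite -(odd_double_half n); case: (odd n); rewrite /= ?add1n ?add0n.
  rewrite addSn -doubleD !collatz_odd -[LHS](periodic_mod _ _ _ fN).
  rewrite -[RHS](periodic_mod _ _ _ fN); congr (f _).
  by rewrite (_ : (3 * _ + 2).*2 = 6 * N + (3 * n./2 + 2).*2)%N ?modnMDl//; lia.
by rewrite -doubleD !collatz_even fN.
Qed.

(** Invariance of the measure under a single step of T.  The weights 1/6
    and 1/12 are what makes the contributions match: the classes of even u
    cover all residues once with weight 1/6, those of odd u cover the even
    residues with weight 1/12 and multiplicity 2, so that even residues get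
    1/3 and odd ones 1/6, twice the original weights. *)
Lemma sum_collatz {R : realType} (k : nat) (f : nat -> R) :
  (0 < k)%N -> periodic (2 ^ k) f ->
  \sum_(0 <= u < 2 ^ k.+1) nu R u * f (collatz u) =
  2%:R * \sum_(0 <= v < 2 ^ k) nu R v * f v.
Proof.
case: k => [//|k] _ fk.
have split2 (g : nat -> R) n :
    \sum_(0 <= u < 2 ^ n.+1) g u =
    \sum_(0 <= u < 2 ^ n) (g (u.*2) + g (u.*2.+1)).
  rewrite expnSr big_nat_block; apply: eq_bigr => u _.
  by rewrite big_nat_recr//= big_nat1 muln2 addn0 addn1.
rewrite split2 [in RHS]split2.
under eq_bigr => u _ do
  rewrite /nu /= odd_double collatz_even collatz_odd.
under [in RHS]eq_bigr => u _ do rewrite /nu /= odd_double.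
rewrite !big_split/= -!mulr_sumr.
have fk2 : periodic (2 ^ k) (fun u => f u.*2).
  by move=> u; rewrite doubleD -(mul2n (2 ^ k)%N) -expnS fk.
have fk3 : periodic (2 ^ k.+1) (fun u => f u.*2).
  by move=> u; rewrite doubleD -(addnn (2 ^ _)%N) addnA !fk.
(* T (2 u + 1) = 2 (3 u + 2), and u |-> 3 u + 2 is a permutation. *)
rewrite (sum_periodic_affine _ 3 2 _ fk3) ?coprimeXl//.
rewrite (_ : \sum_(0 <= u < 2 ^ k.+1) f u.*2 =
             2%:R * \sum_(0 <= u < 2 ^ k) f u.*2); last by rewrite expnS (sum_periodic_block _ _ _ fk2).
rewrite split2 big_split/=.
lra.
Qed.

Lemma sum_collatz3 {R : realType} (k : nat) (f : nat -> R) :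
  (0 < k)%N -> periodic (2 ^ k) f ->
  \sum_(0 <= u < 2 ^ k.+3) nu R u * f (collatz3 u) =
  8%:R * \sum_(0 <= v < 2 ^ k) nu R v * f v.
Proof.
move=> k0 fk.
have f1 : periodic (2 ^ k.+1) (f \o collatz).
  by rewrite expnS mul2n; exact: periodic_collatz.
have f2 : periodic (2 ^ k.+2) (f \o collatz \o collatz).
  by rewrite expnS mul2n; exact: periodic_collatz.
rewrite (sum_collatz k.+2 _ _ f2)// (sum_collatz k.+1 _ _ f1)//.
by rewrite (sum_collatz k _ _ fk)// !mulrA -!natrM.
Qed.

Lemma pow8 (m : nat) : (8 ^ m = 2 ^ (3 * m))%N.
Proof. by rewrite expnM. Qed.

Lemma periodic_collatz3 {V : Type} (m : nat) (f : nat -> V) :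
  periodic (8 ^ m) f -> periodic (8 ^ m.+1) (f \o collatz3).
Proof.
move=> /periodic_collatz/periodic_collatz/periodic_collatz.
by rewrite -!mul2n !mulnA -expnS.
Qed.

Lemma periodic_modn (N : nat) : periodic N (modn^~ N).
Proof. by move=> n; rewrite modnDr. Qed.

Lemma collatz3_mod (m n : nat) :
  collatz3 (n %% 8 ^ m.+1) = collatz3 n %[mod 8 ^ m].
Proof.
exact: (periodic_mod _ _ n (periodic_collatz3 m _ (periodic_modn (8 ^ m)))).
Qed.

Lemma collatz_gt0 (n : nat) : (0 < n)%N -> (0 < collatz n)%N.
Proof. rewrite /collatz; case: ifP => ?; lia. Qed.

Lemma collatz3_gt0 (n : nat) : (0 < n)%N -> (0 < collatz3 n)%N.
Proof. by move=> n0; do 3!apply: collatz_gt0. Qed.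

Lemma nu_gt0 (R : realType) (i : nat) : 0 < nu R i.
Proof. by rewrite /nu; case: ifP; rewrite invr_gt0 ltr0n. Qed.

Lemma nu_mod (R : realType) (m n : nat) : (0 < m)%N ->
  nu R (n %% 8 ^ m) = nu R n.
Proof.
move=> m0; rewrite /nu; suff -> : odd (n %% 8 ^ m) = odd n by [].
by rewrite [in RHS](divn_eq n (8 ^ m)) oddD oddM oddX (gtn_eqF m0) andbF.
Qed.

(** * The transition matrix *)

(** The set is a union of classes modulo 8 ^ (m + 1), one level finer than those
    of the states, because S forgets one digit in base 8.  The index u = 0 needs
    no exception: T 0 = 0 is compatible with reduction modulo powers of 2. *)
Lemma mu_inv_transition (R : realType) (m : nat) (i j : 'I_(8 ^ m)) :
  mu_inv R (residue_class i (8 ^ m) `&`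
            collatz3 @^-1` residue_class j (8 ^ m))%classic =
  \sum_(0 <= u < 8 ^ m.+1 | (u %% 8 ^ m == i)%N && (collatz3 u %% 8 ^ m == j)%N)
     nu R u / 8%:R ^+ m.
Proof.
rewrite big_mkord.
apply: (@mu_invE R _ m.+1 [set u : 'I__ | (u %% 8 ^ m == i)%N &&
   (collatz3 u %% 8 ^ m == j)%N]%SET); split => //; last first.
  by apply: eq_bigl => u; rewrite inE.
apply/seteqP; split=> n.
  move=> [/= /residue_classP[n0 ni] /residue_classP[_ Sj]].
  have lt : (n %% 8 ^ m.+1 < 8 ^ m.+1)%N by rewrite ltn_mod expn_gt0.
  exists (Ordinal lt); last exact/residue_classP.
  rewrite /= inE /= collatz3_mod modn_dvdm ?dvdn_exp2l//.
  by apply/andP; split; apply/eqP.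
move=> [u /=]; rewrite inE => /andP[/eqP ui /eqP uj] /residue_classP[n0 nu].
split; apply/residue_classP; split => //.
- by rewrite -ui -nu modn_dvdm// dvdn_exp2l.
- exact: collatz3_gt0.
- by rewrite -uj -nu collatz3_mod.
Qed.

(** A transition draws the next base-8 digit of the state uniformly and then
    applies S: nu depends on the parity only, so the eight lifts of i are
    equally likely. *)
Lemma collatz_matrixE (R : realType) (m : nat) (i j : 'I_(8 ^ m)) : (0 < m)%N ->
  collatz_matrix R m i j =
  8%:R^-1 * \sum_(0 <= u < 8 ^ m.+1)
     (u %% 8 ^ m == i)%N%:R * (collatz3 u %% 8 ^ m == j)%N%:R.
Proof.
move=> m0; rewrite mxE mu_inv_transition mu_inv_class// mulr_suml mulr_sumr.
rewrite big_mkcond; apply: eq_bigr => u _.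
case: eqP => /= [ui|_]; last by rewrite mul0r mulr0.
case: eqP => /= _; last by rewrite !mulr0.
rewrite -ui nu_mod// !mulr1 -[in 8%:R ^+ m](prednK m0) exprS.
set c := 8%:R ^+ _; have c0 : c != 0 by rewrite expf_eq0 pnatr_eq0 andbF.
have nu0 : nu R u != 0 by rewrite gt_eqF// nu_gt0.
by field; rewrite c0 nu0.
Qed.

Lemma sum_residue {R : realType} (n N : nat) (F : nat -> R) : (0 < N)%N ->
  \sum_(j < N) (n %% N == j)%N%:R * F j = F (n %% N)%N.
Proof.
move=> N0; have lt : (n %% N < N)%N by rewrite ltn_mod.
rewrite (bigD1 (Ordinal lt))//= eqxx mul1r big1 ?addr0// => j nj.
rewrite (_ : _ == _ = false) ?mul0r//; apply: contraNF nj => /eqP nj.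
by apply/eqP/val_inj; rewrite /= nj.
Qed.

Lemma sum_residue_nat {R : realType} (N j : nat) (F : nat -> R) : (j < N)%N ->
  \sum_(0 <= v < N) F v * (v %% N == j)%N%:R = F j.
Proof.
move=> jN; rewrite big_mkord (bigD1 (Ordinal jN))//= modn_small// eqxx mulr1.
rewrite big1 ?addr0// => v nv; rewrite modn_small//.
by rewrite (_ : _ == _ = false) ?mulr0//; exact: negbTE nv.
Qed.

(** * Stochasticity and stationarity *)

Lemma collatz_matrix_stochastic (R : realType) (m : nat) : (0 < m)%N ->
  stochastic (collatz_matrix R m).
Proof.
move=> m0; split=> [i j|i].
  rewrite collatz_matrixE// mulr_ge0 ?invr_ge0//.
  by apply: sumr_ge0 => u _; rewrite mulr_ge0.
under eq_bigr => j _ do rewrite collatz_matrixE//.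
rewrite -mulr_sumr exchange_big/=.
under eq_bigr => u _.
  rewrite -mulr_sumr.
  under eq_bigr => j _ do rewrite -[_%:R]mulr1.
  rewrite (sum_residue _ _ (fun=> 1)) ?expn_gt0//.
  over.
rewrite expnS (sum_periodic_block (8 ^ m)); last by move=> u; rewrite modnDr.
under eq_bigr => u _ do rewrite mulr1 -[_%:R]mul1r.
by rewrite (sum_residue_nat _ _ (fun=> 1))// mulr1 mulVf// pnatr_eq0.
Qed.

(** The entry of index j of the product is a weighted count of the preimages of
    j under S among the residues modulo 8 ^ (m + 1), so [sum_collatz3] applies to
    the indicator of the class of j. *)
Lemma nu_stationary (R : realType) (m : nat) : (0 < m)%N ->
  stationary_distribution (collatz_matrix R m)
    (\row_(i < 8 ^ m) (nu R i / 8%:R ^+ m.-1)).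
Proof.
move=> m0; split=> [i||].
- by rewrite mxE divr_ge0// ?exprn_ge0// ltW// nu_gt0.
- under eq_bigr => i _ do rewrite mxE.
  rewrite -mulr_suml -(big_mkord xpredT (nu R)).
  rewrite (_ : (8 ^ m = (4 * 8 ^ m.-1) * 2)%N); last first.
    by rewrite -[in LHS](prednK m0) expnS mulnAC.
  rewrite sum_periodic_block; last by move=> u; rewrite /nu oddD addbF.
  rewrite big_nat_recr//= big_nat1 /nu/= natrM natrX.
  set c := 8%:R ^+ _; have c0 : c != 0 by rewrite expf_eq0 pnatr_eq0 andbF.
  by field.
- apply/rowP => j; rewrite !mxE.
  under eq_bigr => i _ do rewrite mxE collatz_matrixE// mulrCA mulr_sumr.
  rewrite -mulr_sumr exchange_big/=.
  under eq_bigr => u _.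
    under eq_bigr => i _ do rewrite mulrCA.
    rewrite (sum_residue _ _ (fun i => nu R i / 8%:R ^+ m.-1 * _)) ?expn_gt0//.
    rewrite nu_mod// mulrAC.
    over.
  pose f v : R := (v %% 8 ^ m == j)%N%:R.
  have fm : periodic (2 ^ (3 * m)) f by move=> v; rewrite /f -pow8 modnDr.
  have := sum_collatz3 (3 * m) f _ fm; rewrite muln_gt0 m0 => /(_ isT).
  rewrite -mulr_suml (_ : (3 * m).+3 = 3 * m.+1)%N; last by rewrite mulnS.
  rewrite -!pow8 => ->; rewrite sum_residue_nat//.
  by rewrite -mulrA mulKf// pnatr_eq0.
Qed.

(** * Invariant vectors of a stochastic matrix *)

Lemma invariant_connect_gt0 {R : realType} {n : nat} (P : 'M[R]_n)
    (v : 'rV[R]_n) (i j : 'I_n) :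
  (forall k l, 0 <= P k l) -> (forall k, 0 <= v 0 k) -> v *m P = v ->
  connect (fun k l => 0 < P k l) i j -> 0 < v 0 i -> 0 < v 0 j.
Proof.
move=> P0 v0 vP /connectP[s + ->]; elim: s i => [//|k s IH] i /= /andP[ik ks] vi.
apply: IH ks _; rewrite -vP mxE (bigD1 i)//= ltr_wpDr ?mulr_gt0//.
by apply: sumr_ge0 => l _; rewrite mulr_ge0.
Qed.

(** The triangle inequality gives |v| <= |v| P entrywise, and the two sides have
    the same total mass because the rows of P sum to 1. *)
Lemma invariant_abs {R : realType} {n : nat} (P : 'M[R]_n) (v : 'rV[R]_n) :
  stochastic P -> v *m P = v ->
  (\row_i `|v 0 i|) *m P = \row_i `|v 0 i|.
Proof.
move=> [P0 P1] vP; apply/rowP => j.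
have le k : `|v 0 k| <= \sum_i `|v 0 i| * P i k.
  rewrite -{1}vP mxE (le_trans (ler_norm_sum _ _ _))// ler_sum// => i _.
  by rewrite normrM [`|P i k|]ger0_norm.
have eqs : \sum_k (\sum_i `|v 0 i| * P i k - `|v 0 k|) = 0.
  rewrite sumrB exchange_big/=; under eq_bigr => i _ do rewrite -mulr_sumr P1 mulr1.
  by rewrite subrr.
move/eqP: eqs; rewrite psumr_eq0; last by move=> k _; rewrite subr_ge0.
move=> /allP /(_ j (mem_index_enum j)) /=; rewrite subr_eq0 => /eqP vj.
by rewrite !mxE -vj; apply: eq_bigr => i _; rewrite mxE.
Qed.

(** Up to replacing v by - v, the vector |v| - v vanishes at j0; being nonnegative
    and invariant, it would be positive at j0 if it were positive anywhere. *)
Lemma invariant_sum0 {R : realType} {n : nat} (P : 'M[R]_n) (j0 : 'I_n)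
    (v : 'rV[R]_n) :
  stochastic P -> (forall i, connect (fun k l => 0 < P k l) i j0) ->
  v *m P = v -> \sum_i v 0 i = 0 -> v = 0.
Proof.
move=> PS Pj0.
wlog vj0 : v / 0 <= v 0 j0.
  move=> H vP vs; case: (leP 0 (v 0 j0)) => [/H/(_ vP vs)//|vj].
  apply: oppr_inj; rewrite oppr0; apply: H.
  - by rewrite mxE oppr_ge0 ltW.
  - by rewrite mulNmx vP.
  - by under eq_bigr => i _ do rewrite mxE; rewrite sumrN vs oppr0.
move=> vP vs; have [P0 _] := PS.
pose w : 'rV[R]_n := \row_i `|v 0 i| - v.
have wE i : w 0 i = `|v 0 i| - v 0 i by rewrite !mxE.
have w_ge0 i : 0 <= w 0 i by rewrite wE subr_ge0 ler_norm.
have wP : w *m P = w by rewrite mulmxBl invariant_abs// vP.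
have v_ge0 i : 0 <= v 0 i.
  case: (leP 0 (v 0 i)) => // vi.
  have wi : 0 < w 0 i by rewrite wE subr_gt0 (lt_le_trans vi).
  have := invariant_connect_gt0 P w i j0 P0 w_ge0 wP (Pj0 i) wi.
  by rewrite wE ger0_norm// subrr ltxx.
apply/rowP => i; rewrite mxE; move/eqP: vs; rewrite psumr_eq0//.
by move=> /allP /(_ i (mem_index_enum i)) /eqP.
Qed.

(** * Accessibility of the class of 0 *)

(** Induction on L along the orbit of x: an even step halves the modulus, and an
    odd step followed by its forced halving also halves it, at the price of a
    factor 3 on t. *)
Lemma iter_collatz_affine (L x : nat) : exists N b, forall t,
  (iter N collatz (x + 2 ^ L * t) = iter N collatz x + 3 ^ b * t)%N.
Proof.
elim: L x => [|L IH] x; first by exists 0%N, 0%N => t; rewrite !expn0 !mul1n.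
have dbl y t : (y.*2 + 2 ^ L.+1 * t = (y + 2 ^ L * t).*2)%N.
  by rewrite expnS -mulnA mul2n doubleD.
rewrite -(odd_double_half x); set y := x./2; case: (odd x) => /=; last first.
  have [N [b Nb]] := IH y; exists N.+1, b => t.
  by rewrite !iterSr add0n dbl !collatz_even.
have [N [b Nb]] := IH (3 * y + 2)%N; exists N.+2, b.+1 => t.
rewrite !iterSr !add1n addSn dbl !collatz_odd !collatz_even.
have -> : (3 * (y + 2 ^ L * t) + 2 = 3 * y + 2 + 2 ^ L * (3 * t))%N by ring.
by rewrite Nb expnSr mulnA.
Qed.

Lemma iter_collatz_dvd (a r z : nat) :
  (2 ^ (a + r) %| z)%N -> (2 ^ a %| iter r collatz z)%N.
Proof.
elim: r z => [|r IH] z; first by rewrite addn0.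
rewrite addnS expnSr => /dvdnP[q ->].
by rewrite iterSr mulnA muln2 collatz_even; apply: IH; rewrite dvdn_mull.
Qed.

(** N steps of T, with N not controlled modulo 3, suffice for divisibility by any
    prescribed power of 2.  Asking for 2 N spare factors 2 leaves room for 2 N
    further halvings, for a total of 3 N steps of T, that is N steps of S. *)
Lemma iter_collatz3_dvd (m x : nat) : exists n k,
  n = x %[mod 8 ^ m] /\ (8 ^ m %| iter k collatz3 n)%N.
Proof.
have [N [b Nb]] := iter_collatz_affine (3 * m) x.
pose M := (2 ^ (3 * m + 2 * N))%N; pose c := iter N collatz x.
have cop : coprime M (3 ^ b) by rewrite coprimeXl// coprimeXr.
(* z is the multiple 3 ^ b t of 3 ^ b congruent to - c modulo M. *)
pose z := chinese M (3 ^ b) (M - c %% M) 0.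
have /dvdnP[t zE] : (3 ^ b %| z)%N by rewrite /dvdn chinese_modr// mod0n.
exists (x + 8 ^ m * t)%N, N; split; first by rewrite addnC mulnC modnMDl.
rewrite (_ : iter N collatz3 _ = iter (N * 3) collatz (x + 8 ^ m * t)%N); last first.
  by rewrite iterM.
rewrite (_ : N * 3 = 2 * N + N)%N; last by rewrite mulnC -[in RHS](mul1n N) mulnA -mulnDl.
rewrite iterD pow8 Nb; apply: iter_collatz_dvd.
rewrite -/M -/c mulnC -zE /dvdn -modnDm chinese_modl// modnDm -modnDml.
by rewrite subnKC ?modnn// ltnW// ltn_mod expn_gt0.
Qed.

Lemma ltn_mod_pow8 (m n : nat) : (n %% 8 ^ m < 8 ^ m)%N.
Proof. by rewrite ltn_mod expn_gt0. Qed.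

(** Every integer orbit of S projects to a path of the chain. *)
Lemma collatz_matrix_gt0 (R : realType) (m n : nat) : (0 < m)%N ->
  0 < collatz_matrix R m (Ordinal (ltn_mod_pow8 m n))
                         (Ordinal (ltn_mod_pow8 m (collatz3 n))).
Proof.
move=> m0; rewrite collatz_matrixE// mulr_gt0 ?invr_gt0// big_mkord.
rewrite (bigD1 (Ordinal (ltn_mod_pow8 m.+1 n)))//= ltr_wpDr//.
  by apply: sumr_ge0 => u _; rewrite mulr_ge0.
by rewrite modn_dvdm ?dvdn_exp2l// collatz3_mod !eqxx mulr1.
Qed.

Lemma connect_zero (R : realType) (m : nat) (i : 'I_(8 ^ m)) : (0 < m)%N ->
  connect (fun k l => 0 < collatz_matrix R m k l) i (Ordinal (ltn_mod_pow8 m 0)).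
Proof.
move=> m0; have [n [k [ni /eqP nk]]] := iter_collatz3_dvd m i.
rewrite (_ : i = Ordinal (ltn_mod_pow8 m n)); last first.
  by apply/val_inj; rewrite /= ni modn_small.
rewrite (_ : Ordinal (ltn_mod_pow8 m 0) = Ordinal (ltn_mod_pow8 m (iter k collatz3 n))); last first.
  by apply/val_inj; rewrite /= nk mod0n.
elim: k {nk} => [|k IH] /=; first exact: connect0.
apply: connect_trans IH (connect1 _); exact: collatz_matrix_gt0.
Qed.

Theorem proposition12 (R : realType) (m : nat) (hm : (1 <= m)%N) :
  let a : R := 6%:R^-1 * (8%:R ^+ (m - 1))^-1 in
  let b : R := 12%:R^-1 * (8%:R ^+ (m - 1))^-1 in
  let Pstat : 'rV[R]_(8 ^ m) :=
    \row_(i < 8 ^ m) (if odd i then b else a) in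
  stochastic (collatz_matrix R m) /\
  stationary_distribution (collatz_matrix R m) Pstat /\
  (forall p : 'rV[R]_(8 ^ m),
     stationary_distribution (collatz_matrix R m) p -> p = Pstat).

Proof.
move=> a b Pstat.
have PE : Pstat = \row_(i < 8 ^ m) (nu R i / 8%:R ^+ m.-1).
  by apply/rowP => i; rewrite !mxE /nu /a /b subn1; case: ifP.
have QS := collatz_matrix_stochastic R m hm.
have Pst : stationary_distribution (collatz_matrix R m) Pstat.
  by rewrite PE; exact: nu_stationary.
split=> //; split=> // p [_ p1 pQ].
have [_ P1 PQ] := Pst.
apply/eqP; rewrite -subr_eq0; apply/eqP.
apply: (invariant_sum0 _ _ _ QS (fun i => connect_zero R m i hm)).
  by rewrite mulmxBl pQ PQ.
under eq_bigr => i _ do rewrite !mxE.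
rewrite sumrB p1 -P1.
by apply/eqP; rewrite subr_eq0; apply/eqP/eq_bigr => i _; rewrite mxE.
Qed.
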